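(* Let $f:\mathbb{R}^n\to\mathbb{R}$ be continuously differentiable, attain its minimum value $f^*=f(x^* )>-\infty$ at some $x^*$, and satisfy the Polyak–Łojasiewicz inequality $\frac12\|\nabla f(x)\|_2^2\ge \mu (f(x)-f^* )$ for all $x\in\mathbb{R}^n$, with $\mu>0$. Let $\mathbb{X}^*$ be the set of minimizers of $f$ over $\mathbb{R}^n$. Let $g=g_p+g_q:\mathbb{R}^n\to\mathbb{R}^n$ with $g_p\in\mathcal{F}_p^{\sigma}$, $g_q\in\mathcal{F}_q^{\rho}$, where $p\in[0,1)$, $q>1$, $\sigma,\rho>0$. Then for every $x_0\in\mathbb{R}^n$, any Filippov solution $x(t)$ of $$\dot x=-g(\nabla f(x)),\qquad x(0)=x_0,$$ converges to $\mathbb{X}^*$ in fixed time $T(x_0)$ bounded by $$T(x_0)\le \frac{1}{\mu\sigma(1-p)}+\frac{1}{\mu\rho(q-1)}.$$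
   Context: For a measurable, locally essentially bounded map $X:\mathbb{R}^n\to\mathbb{R}^n$, the Filippov set-valued map is $\mathcal{F}[X](x)=\bigcap_{\delta>0}\bigcap_{\omega(\mathcal{N}_0)=0}\overline{co}\{X(x^{\delta}\setminus\mathcal{N}_0)\}$, where $x^\delta$ is the open ball of radius $\delta$ centered at $x$, $\omega$ is Lebesgue measure, and $\overline{co}$ is the closed convex hull. A Filippov solution of $\dot x=X(x)$, $x(0)=x_0$, is a (locally) absolutely continuous $x:[0,\infty)\to\mathbb{R}^n$ with $x(0)=x_0$ and $\dot x(t)\in\mathcal{F}[X](x(t))$ for a.e. $t$. A function $g:\mathbb{R}^n\to\mathbb{R}^n$ is sign-preserving if $\mathrm{sign}(g(y))=\mathrm{sign}(y)$ (componentwise signum, $\mathrm{sign}(0)=0$) for all $y$. For $p\ge0$ and $\sigma>0$, $g_p\in\mathcal{F}_p^{\sigma}$ means that $g_p:\mathbb{R}^n\to\mathbb{R}^n$ is measurable, locally essentially bounded, sign-preserving, and $\min_{\eta\in\mathcal{F}[g_p](y)}\eta^Ty\ge\sigma\|y\|_2^{1+p}$ for all $y\in\mathbb{R}^n$. ''$x(t)$ converges to $\mathbb{X}^*$ in time $T(x_0)$'' means $x(t)\in\mathbb{X}^*$ for all $t\ge T(x_0)$.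
   Formalization: Solutions are taken to satisfy x'(t) ∈ −F[g](∇f(x(t))) for a.e. t, instead of x'(t) ∈ F[−g∘∇f](x(t)); with the latter the claim fails, e.g. f = x_1²/2 on R² and g altered on the null axis y_2 = 0. *)

(* Defs.v *)
From mathcomp Require Import all_boot all_order all_algebra.
From mathcomp Require Import all_classical all_reals all_analysis.

Set Implicit Arguments.
Unset Strict Implicit.
Unset Printing Implicit Defensive.

Import Order.TTheory GRing.Theory Num.Theory.
Import numFieldNormedType.Exports.

Local Open Scope classical_set_scope.
Local Open Scope ring_scope.

Section Euclidean.
Context {R : realType} {n : nat}.
Implicit Types (x y a b : 'rV[R]_n) (A : set 'rV[R]_n).

(* The library's norm on 'rV_n is the sup norm; it induces the same topology,
   but the inequalities below are about the Euclidean one. *)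
Definition dotv x y : R := \sum_(i < n) x 0 i * y 0 i.

Definition enorm x : R := Num.sqrt (\sum_(i < n) x 0 i ^+ 2).

Definition eball x (r : R) : set 'rV[R]_n := [set y | enorm (y - x) < r].

Definition open_box a b : set 'rV[R]_n :=
  [set y | forall i, a 0 i < y 0 i < b 0 i].

Definition box_volume a b : R := \prod_(i < n) (b 0 i - a 0 i).

(* n-dimensional Lebesgue outer measure (for n >= 1) *)
Definition lebesgue_outer A : \bar R :=
  ereal_inf [set (\sum_(k <oo) (box_volume (ab k).1 (ab k).2)%:E)%E
            | ab in [set ab : nat -> 'rV[R]_n * 'rV[R]_n |
                (forall k i, (ab k).1 0 i <= (ab k).2 0 i) /\
                A `<=` \bigcup_k open_box (ab k).1 (ab k).2]].

Definition lebesgue_null A : Prop := lebesgue_outer A = 0%E.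

(* Lebesgue measurability, not only Borel measurability *)
Definition lebesgue_measurable_fun (X : 'rV[R]_n -> 'rV[R]_n) : Prop :=
  forall U : set 'rV[R]_n, open U -> lebesgue_outer.-caratheodory (X @^-1` U).

Definition locally_ess_bounded (X : 'rV[R]_n -> 'rV[R]_n) : Prop :=
  forall x, exists r M : R, exists N : set 'rV[R]_n,
    [/\ 0 < r, lebesgue_null N &
        forall y, (eball x r `\` N) y -> enorm (X y) <= M].

Definition closed_convex_hull A : set 'rV[R]_n :=
  \bigcap_(C in [set C : set 'rV[R]_n |
                  [/\ closed C, convex_set C & A `<=` C]]) C.

Definition filippov (X : 'rV[R]_n -> 'rV[R]_n) x : set 'rV[R]_n :=
  \bigcap_(r in [set r : R | 0 < r])
    \bigcap_(N in [set N : set 'rV[R]_n | lebesgue_null N])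
      closed_convex_hull (X @` (eball x r `\` N)).

Definition sign_preserving (g : 'rV[R]_n -> 'rV[R]_n) : Prop :=
  forall y i, Num.sg (g y 0 i) = Num.sg (y 0 i).

Definition classF (p sigma : R) (g : 'rV[R]_n -> 'rV[R]_n) : Prop :=
  [/\ lebesgue_measurable_fun g,
      locally_ess_bounded g,
      sign_preserving g &
      forall y eta, filippov g y eta ->
        sigma * enorm y `^ (1 + p) <= dotv eta y].

Definition gradient (f : 'rV[R]_n -> R) x : 'rV[R]_n :=
  \row_(i < n) 'D_(delta_mx 0 i) f x.

Definition C1 (f : 'rV[R]_n -> R) : Prop :=
  (forall x, differentiable f x) /\ continuous (gradient f).

Definition minimizers (f : 'rV[R]_n -> R) : set 'rV[R]_n :=
  [set x | forall y, f x <= f y].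

Definition polyak_lojasiewicz (mu fstar : R) (f : 'rV[R]_n -> R) : Prop :=
  forall x, mu * (f x - fstar) <= 2^-1 * enorm (gradient f x) ^+ 2.

(* Curves are total functions on R; only their values on [0, +oo[ matter. *)
Definition locally_abs_continuous (x : R -> 'rV[R]_n) : Prop :=
  forall b e : R, 0 < b -> 0 < e -> exists2 d : R, 0 < d &
    forall (m : nat) (s t : 'I_m -> R),
      (forall i, [/\ 0 <= s i, s i <= t i & t i <= b]) ->
      trivIset [set: 'I_m] (fun i => `]s i, t i[%classic) ->
      \sum_(i < m) (t i - s i) < d ->
      \sum_(i < m) enorm (x (t i) - x (s i)) < e.

Definition inclusion_solution (K : 'rV[R]_n -> set 'rV[R]_n)
    (x0 : 'rV[R]_n) (x : R -> 'rV[R]_n) : Prop :=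
  [/\ locally_abs_continuous x, x 0 = x0 &
      {ae (@lebesgue_measure R), forall t : R, 0 <= t ->
         derivable x t 1 /\ K (x t) ('D_1 x t)}].

Definition filippov_solution (X : 'rV[R]_n -> 'rV[R]_n) :=
  inclusion_solution (filippov X).

(* Right-hand side of the Filippov inclusion for x' = - g (phi x), phi
   continuous: the discontinuous map g is regularized at phi x.  The map
   - g \o phi itself need not be measurable or locally essentially bounded, and
   filippov (- g \o phi) may see only the values of g on a null set when the
   range of phi is thin: for f x = x_1 ^ 2 / 2 on R^2 it ignores every value of g
   off the first axis. *)
Definition filippov_comp (g phi : 'rV[R]_n -> 'rV[R]_n) x : set 'rV[R]_n :=
  [set - eta | eta in filippov g (phi x)].

Lemma filippov_solution_comp (g phi : 'rV[R]_n -> 'rV[R]_n) x0 (x : R -> 'rV[R]_n) :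
  (forall z, filippov (fun z => - g (phi z)) z `<=` filippov_comp g phi z) ->
  filippov_solution (fun z => - g (phi z)) x0 x ->
  inclusion_solution (filippov_comp g phi) x0 x.
Proof.
move=> gphi [xac xx0 xsol]; split=> //.
move: xsol; apply: (@filterS _ _ (ae_filter_ringOfSetsType lebesgue_measure)).
by move=> t /= xt /xt[dx Kx]; split=> //; exact: gphi.
Qed.

End Euclidean.

(* Main.v *)
Require Import Defs.
From mathcomp Require Import all_boot all_order all_algebra.
From mathcomp Require Import all_classical all_reals all_analysis.
From mathcomp Require Import measurable_realfun.
From mathcomp Require Import lra.

Import Order.TTheory GRing.Theory Num.Theory.
Import numFieldNormedType.Exports.

Local Open Scope classical_set_scope.
Local Open Scope ring_scope.

(** Along a solution [x] the function [w u := 2 mu (f (x u) - f xstar)] is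
    nonnegative and its derivative is almost everywhere
    [- 2 mu eta . grad f (x u)], with [eta] in the Filippov set of [gp + gq] at
    [grad f (x u)].  Everything follows from the differential inequality
    [w' <= - (c w ^ a + d w ^ b)], where [a = (1 + p) / 2 < 1],
    [b = (1 + q) / 2 > 1], [c = 2 mu sigma] and [d = 2 mu rho].

    The inequality holds because the lower bounds [c_p] and [c_q] of
    [eta . grad f] on the Filippov sets of [gp] and [gq] add up
    ([filippovD_dotv_ge]).  By compactness, which is where local essential
    boundedness enters, a lower bound on a Filippov set at [y] is almost a lower
    bound on the values taken near [y] off a null set
    ([filippov_dotv_ge_near]); bounds on values add, and they pass to the closed
    convex hull since a closed half-space is closed and convex.  The
    Polyak-Lojasiewicz inequality is [w <= |grad f|^2], so that
    [w ^ ((1 + s) / 2) <= |grad f| ^ (1 + s)] for [s = p, q].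

    A differential inequality that holds almost everywhere can be integrated
    because [x] is absolutely continuous: a function whose oscillation is
    locally controlled by that of [x] and whose derivative is almost everywhere
    nonpositive is nonincreasing ([ac_nonincreasing]).  Applied to
    [w ^ (1 - s) / (1 - s) + k u] on an interval where [w] stays away from [0],
    this integrates [w' <= - k w ^ s] ([power_decay]).

    Finally, suppose that [w] were still positive at a time past the bound.
    Since [w] is nonincreasing it is positive before that.  The term with
    [b > 1] brings [w] from any initial value down to at most [1] within
    [1 / (d (b - 1)) = 1 / (mu rho (q - 1))], as [w ^ (1 - b)] grows at speed
    [d (b - 1)]; from there the term with [a < 1] makes [w ^ (1 - a)] decrease
    from at most [1] at speed [c (1 - a)], so that it would become negative
    after a further [1 / (c (1 - a)) = 1 / (mu sigma (1 - p))]
    ([fixed_time_zero]). *)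

Set Implicit Arguments.
Unset Strict Implicit.
Unset Printing Implicit Defensive.

(** * Euclidean norm, scalar product and gradient *)

Section euclidean.
Context {R : realType} {n : nat}.
Implicit Types (f : 'rV[R]_n -> R) (y u v w : 'rV[R]_n).

Lemma dotvDl u v w : dotv (u + v) w = dotv u w + dotv v w.
Proof.
by rewrite /dotv -big_split; apply: eq_bigr => i _; rewrite mxE mulrDl.
Qed.

Lemma dotvZl (l : R) u w : dotv (l *: u) w = l * dotv u w.
Proof. by rewrite /dotv mulr_sumr; apply: eq_bigr => i _; rewrite mxE mulrA. Qed.

Lemma continuous_dotvl w : continuous (fun u => dotv u w).
Proof.
apply: continuous_big; first exact: add_continuous.
move=> i _ u.
apply: (@cvgMr_tmp R _ (nbhs u) _ (fun x : 'rV[R]_n => x 0 i) _ (w 0 i)).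
exact: (@coord_continuous R 1 n 0 i).
Qed.

Lemma mx_norm_le_enorm u : `|u| <= enorm u.
Proof.
rewrite [leLHS]mx_normrE; apply/bigmax_leP; split; first exact: sqrtr_ge0.
move=> [i j] _ /=; rewrite (ord1 i) -sqrtr_sqr; apply: ler_wsqrtr.
by rewrite (bigD1 j)//= lerDl sumr_ge0// => k _; rewrite sqr_ge0.
Qed.

Lemma enorm_ge0 u : 0 <= enorm u. Proof. exact: sqrtr_ge0. Qed.

Lemma enormBC u v : enorm (u - v) = enorm (v - u).
Proof.
congr Num.sqrt; apply: eq_bigr => i _.
by rewrite !mxE -sqrrN opprB.
Qed.

Lemma dotv_le u v : `|dotv u v| <= n%:R * `|v| * enorm u.
Proof.
apply: le_trans (ler_norm_sum _ _ _) _.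
rewrite -mulrA mulr_natl -[X in _ *+ X]card_ord -sumr_const.
apply: ler_sum => i _; rewrite normrM mulrC.
have coord (w : 'rV[R]_n) : `|w 0 i| <= `|w|.
  by rewrite [leRHS]mx_normrE; apply/bigmax_geP; right; exists (0, i).
by apply: ler_pM => //; exact: le_trans (mx_norm_le_enorm u).
Qed.

Lemma diff_gradient f y v : differentiable f y -> 'd f y v = dotv v (gradient f y).
Proof.
move=> df; rewrite [in LHS](row_sum_delta v) linear_sum; apply: eq_bigr => i _.
by rewrite linearZ mxE deriveE.
Qed.

(** The radius depends on [y] but the constant only on the bound [G], so one
    constant serves along a whole compact piece of curve. *)
Lemma differentiable_lipschitz_at f y (G : R) :
  differentiable f y -> `|gradient f y| <= G ->
  exists2 r : R, 0 < r & forall z, `|z - y| < r ->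
    `|f z - f y| <= (n%:R * G + 1) * enorm (z - y).
Proof.
move=> df yG; have [_ E] := (diff_locallyP y f).1 df.
have /eqaddoP/(_ 1 ltr01)/nbhs_ballP[r /= r0 Hr] := E.
exists r => // z zy; have := Hr (z - y).
rewrite -ball_normE /= sub0r normrN => /(_ zy).
rewrite /= !fctE subrK mul1r /= => le.
have {}le : `|f z - f y - 'd f y (z - y)| <= `|z - y| by rewrite -addrA -opprD.
have dle : `|'d f y (z - y)| <= n%:R * G * enorm (z - y).
  rewrite diff_gradient//; apply: le_trans (dotv_le _ _) _.
  by rewrite ler_wpM2r ?enorm_ge0// ler_wpM2l.
have := mx_norm_le_enorm (z - y).
have := ler_normD (f z - f y - 'd f y (z - y)) ('d f y (z - y)).
by rewrite subrK; lra.
Qed.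

End euclidean.

(** * Lower bounds on Filippov sets *)

(** Interleaving a cover of [A] and a cover of [B] gives a cover of the union
    whose volume is the sum of the two volumes. *)
Lemma lebesgue_nullU (R : realType) (n : nat) (A B : set 'rV[R]_n) :
  lebesgue_null A -> lebesgue_null B -> lebesgue_null (A `|` B).
Proof.
move=> A0 B0.
have vol0 (ab : nat -> 'rV[R]_n * 'rV[R]_n) :
    (forall k i, (ab k).1 0 i <= (ab k).2 0 i) ->
    forall k, (0 <= (box_volume (ab k).1 (ab k).2)%:E)%E.
  by move=> le k; rewrite lee_fin prodr_ge0// => i _; rewrite subr_ge0.
apply/eqP; rewrite eq_le; apply/andP; split; last first.
  apply: le_ereal_inf_tmp => _ [ab [le _] <-].
  by apply: nneseries_ge0 => k _ _; exact: vol0.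
apply/lee_addgt0Pr => e e0; rewrite add0e.
have e20 : (0 < (e / 2)%:E)%E by rewrite lte_fin divr_gt0.
have cover (C : set 'rV[R]_n) : lebesgue_null C ->
    exists ab : nat -> 'rV[R]_n * 'rV[R]_n,
      [/\ forall k i, (ab k).1 0 i <= (ab k).2 0 i,
          C `<=` \bigcup_k open_box (ab k).1 (ab k).2 &
          (\sum_(k <oo) (box_volume (ab k).1 (ab k).2)%:E < (e / 2)%:E)%E].
  move=> C0; have : (lebesgue_outer C < (e / 2)%:E)%E by rewrite C0.
  by move=> /ereal_inf_lt[_ [ab [? ?] <-] ?]; exists ab; split.
have [u [ule uA us]] := cover A A0.
have [v [vle vB vs]] := cover B B0.
pose w k := if odd k then v k./2 else u k./2.
have w_even k : w k.*2 = u k by rewrite /w odd_double doubleK.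
have w_odd k : w k.*2.+1 = v k by rewrite /w /= odd_double /= uphalf_double.
have wle k i : (w k).1 0 i <= (w k).2 0 i by rewrite /w; case: ifP.
apply: (@le_trans _ _ (\sum_(k <oo) (box_volume (w k).1 (w k).2)%:E)%E).
  apply: ereal_inf_lbound; exists w => //; split=> // x [/uA|/vB] [k _ xk].
    by exists k.*2 => //; rewrite w_even.
  by exists k.*2.+1 => //; rewrite w_odd.
apply: lime_le; first by apply: is_cvg_nneseries => k _ _; exact: vol0.
near=> m.
(* The first [2 m] boxes of [w] are the first [m] boxes of [u] and of [v]. *)
pose s (ab : nat -> 'rV[R]_n * 'rV[R]_n) k :=
  (\sum_(0 <= i < k) (box_volume (ab i).1 (ab i).2)%:E)%E.
have mono : (s w m <= s w m.*2)%E.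
  have m2 : (m <= m.*2)%N by rewrite -addnn leq_addr.
  rewrite /s (big_cat_nat (leq0n m) m2) /=.
  by rewrite leeDl// sume_ge0// => i _; exact: vol0.
have split_sum k : s w k.*2 = (s u k + s v k)%E.
  elim: k => [|k IH]; first by rewrite /s !big_geq ?adde0.
  rewrite doubleS /s !big_nat_recr//= -/(s w k.*2) IH.
  by rewrite w_even w_odd -addeA addeACA.
apply: (le_trans mono); rewrite split_sum (splitr e) EFinD.
have le_sum (ab : nat -> 'rV[R]_n * 'rV[R]_n) :
    (forall k i, (ab k).1 0 i <= (ab k).2 0 i) ->
    (s ab m <= \sum_(k <oo) (box_volume (ab k).1 (ab k).2)%:E)%E.
  by move=> le; apply: nneseries_lim_ge => k _ _; exact: vol0.
exact: leeD (le_trans (le_sum u ule) (ltW us)) (le_trans (le_sum v vle) (ltW vs)).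
Unshelve. all: by end_near. Qed.

Lemma closed_convex_hull_min (R : realType) (n : nat) (A C : set 'rV[R]_n) :
  closed C ->
  (forall x y (l : R), 0 <= l <= 1 -> C x -> C y -> C (l *: x + (1 - l) *: y)) ->
  A `<=` C -> closed_convex_hull A `<=` C.
Proof.
move=> cC conv AC; apply: bigcap_inf; split=> // x y l /set_mem Cx /set_mem Cy.
by apply/mem_set; apply: conv => //; apply/andP; split.
Qed.

Lemma closed_closed_convex_hull (R : realType) (n : nat) (A : set 'rV[R]_n) :
  closed (closed_convex_hull A).
Proof. by apply: closed_bigI => C []. Qed.

Lemma closed_convex_hullS (R : realType) (n : nat) (A B : set 'rV[R]_n) :
  A `<=` B -> closed_convex_hull A `<=` closed_convex_hull B.
Proof.
by move=> AB x Ax C [cC kC BC]; apply: Ax; split=> //; exact: subset_trans BC.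
Qed.

(** If the conclusion failed, the parts of the closed convex hulls of
    [g (eball y r `\` N)] lying in the half-space [eta . v <= c - e] would all be
    nonempty.  They form a filter base as [r] shrinks and [N] grows, and one of
    them is compact by local essential boundedness, so they have a common point:
    an element [eta] of the Filippov set with [eta . v < c]. *)
Lemma filippov_dotv_ge_near (R : realType) (n : nat) (g : 'rV[R]_n -> 'rV[R]_n)
    (y v : 'rV[R]_n) (c e : R) :
  locally_ess_bounded g -> 0 < e ->
  (forall eta, filippov g y eta -> c <= dotv eta v) ->
  exists r : R, exists N, [/\ 0 < r, lebesgue_null N &
    forall z, (eball y r `\` N) z -> c - e <= dotv (g z) v].
Proof.
move=> gb e0 gc; apply: contrapT => none.
have low r N : 0 < r -> lebesgue_null N ->
    exists2 z, (eball y r `\` N) z & dotv (g z) v <= c - e.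
  move=> r0 N0; apply: contrapT => noz; apply: none.
  exists r, N; split=> // z zN; rewrite leNgt; apply/negP => /ltW zc.
  by apply: noz; exists z.
have [r0 [M [N0 [r00 N00 gM]]]] := gb y.
pose D := [set i : R * set 'rV[R]_n | 0 < i.1 /\ lebesgue_null i.2].
pose H i := closed_convex_hull (g @` (eball y i.1 `\` i.2)).
pose K (i : R * set 'rV[R]_n) := H i `&` [set eta | dotv eta v <= c - e].
have Kclosed i : closed (K i).
  apply: closedI; first exact: closed_closed_convex_hull.
  by apply: (@closed_comp _ _ (fun u => dotv u v) [set s | s <= c - e]);
    [move=> u _; exact: continuous_dotvl | exact: closed_le].
have K0 : D (r0, N0) by [].
have FK : ProperFilter (filter_from D K).
  apply: filter_from_proper.
    apply: filter_from_filter; first by exists (r0, N0).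
    move=> [r N] [s P] /= [/= rp Nn] [/= sp Pn].
    exists (Num.min r s, N `|` P).
      by split=> /=; [rewrite lt_min rp sp|exact: lebesgue_nullU].
    have sub (r' : R) (N' : set 'rV[R]_n) :
        Num.min r s <= r' -> N' `<=` N `|` P ->
        H (Num.min r s, N `|` P) `<=` H (r', N').
      move=> rr' NN; apply: closed_convex_hullS => _ [z [/= zr zN] <-].
      by exists z => //; split=> [|/NN//]; exact: lt_le_trans rr'.
    move=> u [Hu uv]; split; split=> //; apply: sub Hu.
    - by rewrite ge_min lexx.
    - exact: subsetUl.
    - by rewrite ge_min lexx orbT.
    - exact: subsetUr.
  move=> [r N] [/= rp Nn]; have [z zN zc] := low r N rp Nn.
  by exists (g z); split=> // C [_ _]; apply; exists z.
have Kcompact : compact (K (r0, N0)).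
  apply: bounded_closed_compact => //.
  exists M; split=> [|s Ms u [Hu _] /=]; first exact: num_real.
  apply: le_trans (ltW Ms).
  apply: (@closed_convex_hull_min _ _ (g @` (eball y r0 `\` N0))
    [set u | `|u| <= M] _ _ _ u Hu).
  - apply: (@closed_comp _ _ (fun u : 'rV[R]_n => `|u|) [set s | s <= M]).
      by move=> w _; exact: norm_continuous.
    exact: closed_le.
  - move=> w z l /andP[l0 l1] /= wM zM.
    rewrite (le_trans (ler_normD _ _))// !normrZ !ger0_norm ?subr_ge0//.
    have : l * `|w| <= l * M by exact: ler_wpM2l.
    have : (1 - l) * `|z| <= (1 - l) * M by apply: ler_wpM2l; rewrite ?subr_ge0.
    lra.
  - by move=> _ [z zN <-] /=; rewrite (le_trans (mx_norm_le_enorm _))// gM.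
have [|eta [_ etaK]] := Kcompact _ FK; first by exists (r0, N0).
have inK i : D i -> K i eta.
  move=> Di; rewrite (closure_id (K i)).1// => A etaA.
  by apply: etaK => //; exists i.
have eta_in : filippov g y eta.
  by move=> r r0' N N0'; have [] := inK (r, N) (conj r0' N0').
by have [_ /= le] := inK _ K0; have := gc eta eta_in; lra.
Qed.

(** Near [y] and off a null set the values of [g + h] lie in the half-space
    [eta . v >= c + d - e], hence so does the Filippov set of [g + h]. *)
Lemma filippovD_dotv_ge (R : realType) (n : nat) (g h : 'rV[R]_n -> 'rV[R]_n)
    (y v : 'rV[R]_n) (c d : R) :
  locally_ess_bounded g -> locally_ess_bounded h ->
  (forall eta, filippov g y eta -> c <= dotv eta v) ->
  (forall eta, filippov h y eta -> d <= dotv eta v) ->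
  forall eta, filippov (fun z => g z + h z) y eta -> c + d <= dotv eta v.
Proof.
move=> gb hb gc hd eta Feta; apply/ler_addgt0Pr => e e0.
have e20 : 0 < e / 2 by rewrite divr_gt0.
have [r [N [r0 N0 gN]]] := filippov_dotv_ge_near gb e20 gc.
have [s [P [s0 P0 hP]]] := filippov_dotv_ge_near hb e20 hd.
rewrite -lerBlDr.
have m0 : 0 < Num.min r s by rewrite lt_min r0.
have := Feta _ m0 _ (lebesgue_nullU N0 P0).
apply: (@closed_convex_hull_min _ _ _ [set u | c + d - e <= dotv u v]).
- apply: (@closed_comp _ _ (fun u => dotv u v) [set t | c + d - e <= t]).
    by move=> u _; exact: continuous_dotvl.
  exact: closed_ge.
- move=> u w l /andP[l0 l1] /= hu hw; rewrite dotvDl !dotvZl.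
  have : l * (c + d - e) <= l * dotv u v by exact: ler_wpM2l.
  have : (1 - l) * (c + d - e) <= (1 - l) * dotv w v.
    by apply: ler_wpM2l; rewrite ?subr_ge0.
  by lra.
- move=> _ [z [/= zr zN] <-] /=; rewrite dotvDl.
  have : c - e / 2 <= dotv (g z) v.
    apply: gN; split=> [|?]; last by apply: zN; left.
    by apply: lt_le_trans zr _; rewrite ge_min lexx.
  have : d - e / 2 <= dotv (h z) v.
    apply: hP; split=> [|?]; last by apply: zN; right.
    by apply: lt_le_trans zr _; rewrite ge_min lexx orbT.
  by lra.
Qed.

(** * Monotonicity from the sign of the derivative almost everywhere *)

(** Compactness of [[a, b]] in the form of an induction: the supremum of the
    points that satisfy [P] can be stepped over, hence is [b]. *)
Lemma creeping_induction (R : realType) (P : R -> Prop) (a b : R) :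
  a <= b -> P a ->
  (forall u, a <= u <= b -> exists2 r : R, 0 < r & forall c d,
     a <= c -> c <= u -> u <= d -> d <= b -> u - r < c -> d < u + r ->
     P c -> P d) ->
  P b.
Proof.
move=> ab Pa step.
pose S := [set c | a <= c <= b /\ P c].
have Sa : S a by split; rewrite ?lexx.
have Sb : ubound S b by move=> c [/andP[]].
have hS : has_sup S by split; [exists a | exists b].
have au : a <= sup S by apply: sup_upper_bound.
have ub : sup S <= b by apply: ge_sup => //; exists a.
have [|r r0 stepu] := step (sup S); first by rewrite au.
have [c [/andP[ac cb] Pc] uc] := sup_adherent r0 hS.
have cu : c <= sup S by apply: sup_upper_bound => //; split; rewrite ?ac.
pose d := Num.min b (sup S + r / 2).
have ud : sup S <= d by rewrite le_min ub /=; lra.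
have db : d <= b by rewrite ge_min lexx.
have Pd : P d.
  by apply: (stepu c) => //; rewrite gt_min; apply/orP; right; lra.
have du : d <= sup S.
  apply: sup_upper_bound => //; split=> //.
  by rewrite db andbT (le_trans au).
have [bu|ub'] := leP b (sup S + r / 2); first by rewrite -(min_l bu).
by move: du; rewrite /d (min_r (ltW ub')); lra.
Qed.

Lemma sum_itv_length_le (R : realType) (U : set R) (m : nat) (s t : 'I_m -> R) :
  open U -> (forall i, s i <= t i) -> (forall i, `]s i, t i[ `<=` U) ->
  trivIset [set: 'I_m] (fun i => `]s i, t i[%classic) ->
  ((\sum_(i < m) (t i - s i))%:E <= (@lebesgue_measure R) U)%E.
Proof.
move=> oU st sU tst.
have mI i : measurable (`]s i, t i[%classic : set R) by exact: measurable_itv.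
have -> : (\sum_(i < m) (t i - s i))%:E =
    (\sum_(i < m) (@lebesgue_measure R) `]s i, t i[%classic)%E.
  rewrite -sumEFin; apply: eq_bigr => i _.
  rewrite lebesgue_measure_itv /= lte_fin.
  by case: ltP => // ts; congr EFin; apply/eqP; rewrite subr_eq0 eq_le ts st.
rewrite -(measure_semi_additive_ord lebesgue_measure) //; last first.
  exact: bigsetU_measurable.
apply: le_measure; rewrite ?inE.
- exact: bigsetU_measurable.
- exact: open_measurable.
- by elim/big_ind: _ => // A B AU BU; rewrite subUset.
Qed.

(** Successive, hence disjoint, open intervals of [U] in [[a, c]], indexed by
    [nat] so that one more can be appended without changing the index type. *)
Definition chain (R : realType) (U : set R) (a c : R) m (s t : nat -> R) :=
  [/\ forall i, (i < m)%N -> [/\ a <= s i, s i <= t i, t i <= c &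
                                `]s i, t i[ `<=` U] &
      forall i j, (i < j < m)%N -> t i <= s j].

Lemma chain_rcons (R : realType) (U : set R) (a c d e : R) m s t :
  chain U a c m s t -> a <= c -> c <= d -> d <= e -> `]d, e[ `<=` U ->
  chain U a e m.+1 (fun i => if (i < m)%N then s i else d)
                   (fun i => if (i < m)%N then t i else e).
Proof.
move=> [H1 H2] ac cd de sU; split=> [i|i j].
  rewrite ltnS leq_eqVlt => /orP[/eqP->|im].
    by rewrite ltnn; split => //; exact: le_trans cd.
  rewrite im; have [? ? tc ?] := H1 i im; split=> //.
  by rewrite (le_trans tc)// (le_trans cd).
move=> /andP[ij]; rewrite ltnS => jm.
have im : (i < m)%N by exact: leq_trans jm.
rewrite im; case: ifPn => [jm'|_]; first by apply: H2; rewrite ij.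
by have [_ _ tc _] := H1 i im; exact: le_trans cd.
Qed.

Lemma chain_trivIset (R : realType) (U : set R) (a c : R) m s t :
  chain U a c m s t -> trivIset [set: 'I_m] (fun i => `]s i, t i[%classic).
Proof.
move=> [_ H2]; apply/trivIsetP => i j _ _.
wlog : i j / (i < j)%N => [hw|ij _].
  move=> ij; have [ji|ji|e] := ltngtP i j; first exact: hw ji ij.
    by rewrite setIC; apply: hw ji _; rewrite eq_sym.
  by move: ij; rewrite (val_inj e) eqxx.
apply/seteqP; split=> // u [/=]; rewrite !in_itv /= => /andP[_ ut] /andP[su _].
by have := H2 i j; rewrite ij ltn_ord => /(_ isT); lra.
Qed.

Lemma derivable_le_slope (R : realType) (F : R -> R) (u e : R) :
  derivable F u 1 -> 'D_1 F u <= 0 -> 0 < e ->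
  exists2 r : R, 0 < r & forall c d, c <= u -> u <= d -> u - r < c -> d < u + r ->
    F d - F c <= e * (d - c).
Proof.
move=> dF D0 e0.
have /cvgrPdist_lt/(_ e e0) := dF.
rewrite near_withinE => /nbhs_ballP[r /= r0 Hr].
have slope h : h != 0 -> `|h| < r -> h^-1 * (F (h + u) - F u) < e.
  move=> h0 hr; have := Hr h; rewrite /ball /= sub0r normrN => /(_ hr h0).
  rewrite -[_ *: _]/(_ * _) [h%:A]mulr1 => H.
  have : `|'D_1 F u - h^-1 * (F (h + u) - F u)| < e by [].
  rewrite ltr_norml => /andP[+ _]; lra.
exists r => // c d cu ud uc du.
have right : F d - F u <= e * (d - u).
  move: ud; rewrite le_eqVlt => /orP[/eqP->|ud]; first by rewrite !subrr mulr0.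
  have h0 : 0 < d - u by rewrite subr_gt0.
  have := slope (d - u); rewrite subrK gt_eqF// gtr0_norm// => /(_ isT).
  by rewrite mulrC ltr_pdivrMr// => /(_ _)/ltW; apply; lra.
have left : F u - F c <= e * (u - c).
  move: cu; rewrite le_eqVlt => /orP[/eqP->|cu]; first by rewrite !subrr mulr0.
  have h0 : c - u < 0 by rewrite subr_lt0.
  have := slope (c - u); rewrite subrK lt_eqF// ltr0_norm// => /(_ isT).
  rewrite mulrC ltr_ndivrMr// => /(_ _)/ltW.
  have ur : - (c - u) < r by lra.
  by move=> /(_ ur); lra.
by lra.
Qed.

(** The constant [L] is uniform and the radius [r] is not: this is what
    pointwise differentiation of a function of the curve provides, and it
    suffices to transfer absolute continuity from [x] to [F]. *)
Definition lipschitz_along (R : realType) (n : nat) (x : R -> 'rV[R]_n)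
    (a b : R) (F : R -> R) :=
  exists2 L : R, 0 <= L & forall u : R, a <= u <= b ->
    exists2 r : R, 0 < r & forall v, a <= v <= b -> `|v - u| < r ->
      `|F v - F u| <= L * (enorm (x v - x u) + `|v - u|).

(** Cover the null set of bad times by an open [U] of small measure.  Creeping
    from [a] to [b], the growth of [F] across a good time is at most [e] times the
    elapsed time, while the growth across a bad time is charged to the
    oscillation of [x] on an interval of [U].  The charged intervals are disjoint
    and of small total length, so absolute continuity makes their total
    contribution small. *)
Lemma ac_nonincreasing (R : realType) (n : nat) (x : R -> 'rV[R]_n)
    (F : R -> R) (a b : R) :
  locally_abs_continuous x -> 0 <= a -> a <= b -> lipschitz_along x a b F ->
  {ae (@lebesgue_measure R), forall u, a <= u <= b ->
     derivable F u 1 /\ 'D_1 F u <= 0} ->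
  F b <= F a.
Proof.
move=> xac a0; rewrite le_eqVlt => /orP[/eqP-> //|ab] [L L0 FL] [N [mN N0 badN]].
have b0 : 0 < b by lra.
suff approx (e : R) : 0 < e -> F b - F a <= e * (b - a + L * 2).
  rewrite -subr_le0; apply/ler_addgt0Pr => e e0; rewrite add0r.
  have K0 : 0 < b - a + L * 2 by lra.
  apply: (le_trans (approx (e / (b - a + L * 2)) _)); first by rewrite divr_gt0.
  by rewrite divfK// gt_eqF.
move=> e0; have [d d0 acd] := xac b e b0 e0.
pose d' := Num.min d e.
have d'0 : 0 < d' by rewrite lt_min d0 e0.
have [U [oU NU UN]] : exists U : set R,
    [/\ open U, N `<=` U & ((@lebesgue_measure R) U < d'%:E)%E].
  have [|U [oU NU UN]] := @lebesgue_regularity_outer R N d' mN _ d'0.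
    by rewrite [X in (X < _)%E]N0.
  exists U; split=> //.
  rewrite -(setDUK NU); apply: le_lt_trans UN.
  rewrite (le_trans (measureU2 _ _ _)) //.
    by apply: measurableD => //; exact: open_measurable.
  by rewrite [X in (X + _)%E]N0 add0e.
pose len (s t : nat -> R) i := enorm (x (t i) - x (s i)) + (t i - s i).
pose P c := exists m s t, chain U a c m s t /\
  F c - F a <= e * (c - a) + L * \sum_(i < m) len s t i.
suff [m [s [t [ch le]]]] : P b.
  have [H1 H2] := ch.
  have st (i : 'I_m) : s i <= t i by have [] := H1 i (ltn_ord i).
  have stU (i : 'I_m) : `]s i, t i[ `<=` U by have [] := H1 i (ltn_ord i).
  have total : \sum_(i < m) (t i - s i) < d'.
    rewrite -lte_fin; apply: le_lt_trans UN.
    exact: (sum_itv_length_le oU st stU (chain_trivIset ch)).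
  have incr : \sum_(i < m) enorm (x (t i) - x (s i)) < e.
    apply: (acd m (s \o val) (t \o val)).
    - move=> i; have [as_ _ tb _] := H1 i (ltn_ord i).
      by split; [exact: le_trans a0 as_|exact: st|exact: tb].
    - exact: chain_trivIset ch.
    - by rewrite (lt_le_trans total)// ge_min lexx.
  apply: (le_trans le).
  have : L * \sum_(i < m) len s t i <= L * (e + e).
    rewrite ler_wpM2l// big_split /= lerD ?ltW//.
    by rewrite (lt_le_trans total)// ge_min lexx orbT.
  by lra.
apply: (@creeping_induction R P a b); first exact: ltW.
  exists 0%N, (fun=> a), (fun=> a); split; first by split.
  by rewrite big_ord0; lra.
move=> u uab; have [r r0 HL] := FL u uab.
have /andP[au ub] := uab.
have [Nu|nNu] := pselect (N u); last first.
  have [dF D0] : derivable F u 1 /\ 'D_1 F u <= 0.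
    by apply: contrapT => nD; apply: nNu; apply: badN => /(_ uab).
  have [r' r'0 Hr'] := derivable_le_slope dF D0 e0.
  exists r' => // c v ac cu uv vb rc vr [m [s [t [[H1 H2] le]]]].
  exists m, s, t; split.
    split=> // i im; have [? ? tc ?] := H1 i im.
    by split=> //; rewrite (le_trans tc)// (le_trans cu).
  have := Hr' c v cu uv rc vr; lra.
have /nbhs_ballP[r' /= r'0 Hr'] : nbhs u U.
  by apply: open_nbhs_nbhs; split=> //; exact: NU.
have {}r'0 : 0 < r' := r'0.
have inU v : `|v - u| < r' -> U v.
  by move=> vu; apply: Hr'; rewrite /ball /= distrC.
exists (Num.min r r'); first by rewrite lt_min r0.
move=> c v ac cu uv vb rc vr [m [s [t [ch le]]]].
have [? ?] : u - r < c /\ u - r' < c.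
  have : Num.min r r' <= r /\ Num.min r r' <= r' by rewrite !ge_min !lexx orbT.
  by move=> [? ?]; split; lra.
have [? ?] : v < u + r /\ v < u + r'.
  have : Num.min r r' <= r /\ Num.min r r' <= r' by rewrite !ge_min !lexx orbT.
  by move=> [? ?]; split; lra.
have cU : `]c, u[ `<=` U.
  move=> y /=; rewrite in_itv /= => /andP[? ?]; apply: inU.
  by rewrite ltr_norml; apply/andP; split; lra.
have vU : `]u, v[ `<=` U.
  move=> y /=; rewrite in_itv /= => /andP[? ?]; apply: inU.
  by rewrite ltr_norml; apply/andP; split; lra.
have cF : F u - F c <= L * (enorm (x u - x c) + (u - c)).
  apply: le_trans (ler_norm _) _; rewrite distrC enormBC.
  have -> : u - c = `|c - u| by rewrite ler0_norm ?subr_le0 ?opprB.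
  apply: HL; first by apply/andP; split; lra.
  by rewrite ltr_norml; apply/andP; split; lra.
have vF : F v - F u <= L * (enorm (x v - x u) + (v - u)).
  apply: le_trans (ler_norm _) _.
  have -> : v - u = `|v - u| by rewrite ger0_norm ?subr_ge0.
  apply: HL; first by apply/andP; split; lra.
  by rewrite ltr_norml; apply/andP; split; lra.
(* The bound at [u] only compares values with [F u], so the step from [c] to [v]
   is charged to the two intervals on either side of [u]. *)
have ch1 := chain_rcons ch ac (lexx c) cu cU.
have ch2 := chain_rcons ch1 (le_trans ac cu) (lexx u) uv vU.
do 3 eexists; split; first exact: ch2.
rewrite !big_ord_recr /= /len !ltnn !ltnS !leqnn.
under eq_bigr => i _ do rewrite (ltnS i m) (ltnW (ltn_ord i)) ltn_ord.
move: le; rewrite /len; set S := \sum_(i < m) _ => le.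
have : 0 <= e * (v - c) by apply: mulr_ge0; [exact: ltW|lra].
by lra.
Qed.

(** * Functions controlled by an absolutely continuous curve *)

Section curve.
Context {R : realType} {n : nat}.
Implicit Types (f : 'rV[R]_n -> R) (x : R -> 'rV[R]_n).

Lemma abs_continuous_near x (a b u e : R) : locally_abs_continuous x -> 0 <= a ->
  a <= u <= b -> 0 < e ->
  exists2 r : R, 0 < r & forall v : R, a <= v <= b -> `|v - u| < r ->
    enorm (x v - x u) < e.
Proof.
move=> xac a0 /andP[au ub] e0.
have b1 : 0 < b + 1 by lra.
have [d d0 acd] := xac _ e b1 e0.
have step (s t : R) : a <= s -> s <= t -> t <= b -> t - s < d ->
    enorm (x t - x s) < e.
  move=> as_ st tb td; have := acd 1%N (fun=> s) (fun=> t).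
  rewrite !big_ord1; apply=> //; first by move=> _; split=> //; lra.
  by apply/trivIsetP => i j _ _; rewrite !ord1 eqxx.
exists d => // v /andP[av vb] vu; have [uv|/ltW uv] := leP u v.
  by apply: step => //; rewrite -[ltLHS]ger0_norm ?subr_ge0.
by rewrite enormBC; apply: step => //; rewrite -[ltLHS]ger0_norm ?subr_ge0// distrC.
Qed.

Lemma abs_continuous_within x a b : locally_abs_continuous x -> 0 <= a ->
  {within `[a, b], continuous x}.
Proof.
move=> xac a0; apply/subspace_continuousP => u; rewrite /= in_itv /= => uab.
apply/cvgrPdist_lt => e e0; rewrite near_withinE.
have [r r0 Hr] := abs_continuous_near xac a0 uab e0.
apply/nbhs_ballP; exists r => // v /= uv; rewrite in_itv /= => vab.
rewrite distrC; apply: le_lt_trans (mx_norm_le_enorm _) _; apply: Hr => //.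
by move: uv; rewrite /ball /= distrC.
Qed.

Lemma lipschitz_along_C1 f x (a b : R) : C1 f -> locally_abs_continuous x ->
  0 <= a -> lipschitz_along x a b (f \o x).
Proof.
move=> [df cf] xac a0.
have [G [_ HG]] : bounded_set (gradient f @` (x @` `[a, b])).
  apply: compact_bounded; apply: continuous_compact; first exact: continuous_subspaceT.
  apply: continuous_compact; last exact: segment_compact.
  exact: abs_continuous_within.
pose G1 := Num.max G 0 + 1.
have G10 : 0 <= G1 by rewrite addr_ge0// le_max lexx orbT.
have GG1 : G < G1 by rewrite (@le_lt_trans _ _ (Num.max G 0)) ?le_max ?lexx ?ltrDl.
have L0 : 0 <= n%:R * G1 + 1 by rewrite addr_ge0// mulr_ge0.
exists (n%:R * G1 + 1) => // u uab.
have gu : `|gradient f (x u)| <= G1.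
  by apply: (HG _ GG1); exists (x u) => //; exists u => //=; rewrite in_itv.
have [e e0 He] := differentiable_lipschitz_at (df (x u)) gu.
have [r r0 Hr] := abs_continuous_near xac a0 uab e0.
exists r => // v vab vu; apply: le_trans (He _ _) _.
  exact: le_lt_trans (mx_norm_le_enorm _) (Hr _ vab vu).
by rewrite ler_wpM2l// lerDl.
Qed.

Lemma is_derive_along f x (u : R) : differentiable f (x u) -> derivable x u 1 ->
  is_derive u 1 (f \o x) (dotv ('D_1 x u) (gradient f (x u))).
Proof.
move=> df /derivable1_diffP dx.
have dfx := differentiable_comp dx df.
apply: DeriveDef; first exact/derivable1_diffP.
by rewrite deriveE// diff_comp//= diff_gradient// -deriveE.
Qed.

Lemma lipschitz_alongD x (a b : R) F G :
  lipschitz_along x a b F -> lipschitz_along x a b G ->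
  lipschitz_along x a b (F + G).
Proof.
move=> [L L0 HL] [M M0 HM]; exists (L + M) => [|u uab]; first exact: addr_ge0.
have [r r0 Hr] := HL u uab; have [s s0 Hs] := HM u uab.
exists (Num.min r s); first by rewrite lt_min r0.
move=> v vab; rewrite lt_min => /andP[vr vs].
rewrite !fctE opprD addrACA mulrDl (le_trans (ler_normD _ _))//.
exact: lerD (Hr _ vab vr) (Hs _ vab vs).
Qed.

Lemma lipschitz_alongZ x (a b k : R) F :
  lipschitz_along x a b F -> lipschitz_along x a b (fun t => k * F t).
Proof.
move=> [L L0 HL]; exists (`|k| * L) => [|u uab]; first exact: mulr_ge0.
have [r r0 Hr] := HL u uab; exists r => // v vab vr.
by rewrite -mulrBr normrM -mulrA ler_wpM2l// Hr.
Qed.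

Lemma lipschitz_along_id x (a b : R) : lipschitz_along x a b id.
Proof.
exists 1 => // u uab; exists 1 => // v _ _.
by rewrite mul1r lerDr enorm_ge0.
Qed.

(** Only the values of [h'] along [F] are bounded, because the powers to which
    this applies have a derivative that blows up at [0]. *)
Lemma lipschitz_along_comp x (a b C : R) F (h dh : R -> R) :
  locally_abs_continuous x -> 0 <= a -> lipschitz_along x a b F -> 
  (forall u : R, a <= u <= b -> is_derive (F u) 1 h (dh u) /\ `|dh u| <= C) ->
  lipschitz_along x a b (h \o F).
Proof.
move=> xac a0 [L L0 HL] Hh.
exists ((`|C| + 1) * L) => [|u uab]; first by rewrite mulr_ge0// addr_ge0.
have [dhu dC] := Hh u uab.
have [g [gE gc ga]] := (is_derive1_caratheodory _ _ _).1 dhu.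
have /cvgrPdist_lt/(_ 1 ltr01)/nbhs_ballP[e /= e0 He] := gc.
have [r r0 Hr] := HL u uab.
pose d := e / (L * 2 + 1).
have L1 : 0 < L * 2 + 1 by lra.
have d0 : 0 < d by rewrite divr_gt0.
have de : L * (d + d) < e.
  have : (L * 2 + 1) * d = e by rewrite mulrC divfK// gt_eqF.
  by lra.
have [s s0 Hs] := abs_continuous_near xac a0 uab d0.
exists (Num.min r (Num.min s d)); first by rewrite !lt_min r0 s0.
move=> v vab; rewrite !lt_min => /and3P[vr vs vd].
have Fvu := Hr v vab vr.
have Fe : `|F v - F u| < e.
  apply: le_lt_trans Fvu _; apply: le_lt_trans de.
  by rewrite ler_wpM2l// lerD// ltW// Hs.
have ge : `|g (F v)| <= `|C| + 1.
  have : `|g (F u) - g (F v)| < 1 by apply: He; rewrite /ball /= distrC.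
  rewrite ga distrC => /ltW g1; rewrite -[g (F v)](subrK (dh u)).
  rewrite (le_trans (ler_normD _ _))// addrC lerD//.
  by rewrite (le_trans dC)// ler_norm.
by rewrite /= gE normrM -mulrA ler_pM.
Qed.

End curve.

(** * Fixed-time decay *)

Lemma ae_impl (R : realType) (P Q : R -> Prop) : (forall t, P t -> Q t) ->
  {ae (@lebesgue_measure R), forall t, P t} ->
  {ae (@lebesgue_measure R), forall t, Q t}.
Proof.
by move=> PQ; apply: (@filterS _ _ (ae_filter_ringOfSetsType lebesgue_measure)).
Qed.

Lemma is_derive_powR_primitive (R : realType) (s y : R) : s != 1 -> 0 < y ->
  is_derive y 1 (fun z => (1 - s)^-1 * z `^ (1 - s)) (y `^ (- s)).
Proof.
move=> s1 y0; have s10 : 1 - s != 0 by rewrite subr_eq0 eq_sym.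
have -> : y `^ (- s) = (1 - s)^-1 *: ((1 - s) * y `^ (1 - s - 1)).
  by rewrite /GRing.scale /= mulKf//; congr (_ `^ _); lra.
exact: (is_deriveZ (1 - s)^-1 (is_derive1_powR (1 - s) y0)).
Qed.

(** [u |-> w u ^ (1 - s) / (1 - s) + k u] has derivative [w ^ (- s) w' + k <= 0];
    the lower bound [m] on [w] keeps this function controlled by the curve. *)
Lemma power_decay (R : realType) (n : nat) (x : R -> 'rV[R]_n)
    (w : R -> R) (a b m s k : R) :
  locally_abs_continuous x -> 0 <= a -> a <= b -> lipschitz_along x a b w ->
  0 < m -> (forall u, a <= u <= b -> m <= w u) -> 0 <= s -> s != 1 ->
  {ae (@lebesgue_measure R), forall u, a <= u <= b ->
     derivable w u 1 /\ 'D_1 w u <= - (k * w u `^ s)} ->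
  (1 - s)^-1 * w b `^ (1 - s) + k * (b - a) <= (1 - s)^-1 * w a `^ (1 - s).
Proof.
move=> xac a0 ab wlip m0 mw s0 s1 dw.
pose h (y : R) := (1 - s)^-1 * y `^ (1 - s).
have w0 u : a <= u <= b -> 0 < w u by move=> /mw; exact: lt_le_trans.
have hlip : lipschitz_along x a b (h \o w).
  apply: (@lipschitz_along_comp _ _ _ _ _ (m `^ (- s)) _ h (fun u => w u `^ (- s))) => //.
  move=> u uab; split; first exact: is_derive_powR_primitive (w0 u uab).
  rewrite ger0_norm ?powR_ge0// !powRN lef_pV2 ?posrE ?powR_gt0//; last exact: w0.
  by apply: ge0_ler_powR => //; rewrite ?nnegrE; [exact: ltW|exact/ltW/w0|exact: mw].
suff : h (w b) + k * b <= h (w a) + k * a by rewrite /h; lra.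
apply: (@ac_nonincreasing _ _ x ((h \o w) + (fun t => k * t))) => //.
  by apply: lipschitz_alongD => //; apply: lipschitz_alongZ; exact: lipschitz_along_id.
apply: ae_impl dw => u H uab; have [dwu Dw] := H uab.
have wu := w0 u uab.
have D1 : is_derive u 1 (h \o w) (w u `^ (- s) * 'D_1 w u).
  apply: is_derive1_comp; [exact: is_derive_powR_primitive|exact/derivableP].
have D2 : is_derive u 1 (fun t : R => k * t) k.
  have := is_deriveZ k (is_derive_id u (1 : R)).
  by rewrite [k *: 1]mulr1.
have D := is_deriveD D1 D2.
split; first exact: ex_derive.
rewrite (@derive_val _ _ _ _ _ _ _ D).
have ws : 0 < w u `^ s by exact: powR_gt0.
rewrite powRN.
have : (w u `^ s)^-1 * 'D_1 w u <= (w u `^ s)^-1 * - (k * w u `^ s).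
  by rewrite ler_wpM2l// invr_ge0 ltW.
by rewrite mulrN mulrCA mulVf ?gt_eqF// mulr1; lra.
Qed.

(** Each power integrates to a waiting time: [(d (b - 1))^-1] bounds the time
    needed to come down to [1] from arbitrarily high, since [w ^ (1 - b)] is
    positive at time [0], and [(c (1 - a))^-1] the time needed to go from [1] to
    [0]. *)
Lemma fixed_time_zero (R : realType) (n : nat) (x : R -> 'rV[R]_n)
    (w : R -> R) (a b c d t : R) :
  locally_abs_continuous x -> (forall T, lipschitz_along x 0 T w) ->
  (forall u, 0 <= w u) -> 0 <= a -> a < 1 -> 1 < b -> 0 < c -> 0 < d ->
  {ae (@lebesgue_measure R), forall u, 0 <= u ->
     derivable w u 1 /\ 'D_1 w u <= - (c * w u `^ a + d * w u `^ b)} ->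
  (c * (1 - a))^-1 + (d * (b - 1))^-1 <= t -> w t = 0.
Proof.
move=> xac wlip w0 a0 a1 b1 c0 d0 dw bt.
apply/eqP; rewrite eq_le w0 andbT leNgt; apply/negP => wt.
pose s := (d * (b - 1))^-1.
have a10 : 0 < 1 - a by lra.
have b10 : 0 < b - 1 by lra.
have s0 : 0 < s by rewrite invr_gt0 mulr_gt0.
have ca0 : 0 < (c * (1 - a))^-1 by rewrite invr_gt0 mulr_gt0.
have st : s <= t by rewrite /s; lra.
have lipW (u v : R) : 0 <= u -> lipschitz_along x u v w.
  move=> u0; have [L L0 HL] := wlip v; exists L => // y /andP[uy yv].
  have [|r r0 Hr] := HL y; first by rewrite yv (le_trans u0).
  by exists r => // z /andP[uz zv]; apply: Hr; rewrite zv (le_trans u0).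
have mono (u v : R) : 0 <= u -> u <= v -> w v <= w u.
  move=> u0 uv; apply: (@ac_nonincreasing _ _ x w) => //; first exact: lipW.
  apply: ae_impl dw => y H /andP[uy _].
  have [dwy Dw] := H (le_trans u0 uy); split=> //; apply: (le_trans Dw).
  by rewrite oppr_le0 addr_ge0// mulr_ge0 ?powR_ge0// ltW.
have wtu u : 0 <= u <= t -> w t <= w u by move=> /andP[? ?]; exact: mono.
have phase1 : (1 - b)^-1 * w s `^ (1 - b) + d * (s - 0) <=
    (1 - b)^-1 * w 0 `^ (1 - b).
  apply: (power_decay xac (lexx 0) (ltW s0) (lipW _ _ (lexx 0)) wt) => //.
  - by move=> u /andP[u0 us]; apply: wtu; rewrite u0 (le_trans us).
  - by rewrite ltW// (lt_trans ltr01).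
  - by rewrite gt_eqF.
  - apply: ae_impl dw => u H /andP[u0 _]; have [dwu Dw] := H u0; split=> //.
    by apply: (le_trans Dw); rewrite lerN2 lerDr mulr_ge0 ?powR_ge0// ltW.
have phase2 : (1 - a)^-1 * w t `^ (1 - a) + c * (t - s) <=
    (1 - a)^-1 * w s `^ (1 - a).
  apply: (power_decay xac (ltW s0) st (lipW _ _ (ltW s0)) wt) => //.
  - by move=> u /andP[su ut]; apply: wtu; rewrite ut andbT (le_trans (ltW s0)).
  - by rewrite lt_eqF.
  - apply: ae_impl dw => u H /andP[su _].
    have [dwu Dw] := H (le_trans (ltW s0) su); split=> //.
    by apply: (le_trans Dw); rewrite lerN2 lerDl mulr_ge0 ?powR_ge0// ltW.
have ws1 : w s <= 1.
  rewrite leNgt; apply/negP => ws1.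
  have pw1 : w s `^ (1 - b) <= 1.
    by rewrite -[leRHS](powRr0 (w s)); apply: ler_powR; [exact: ltW|rewrite subr_le0; exact: ltW].
  have w00 : 0 < w 0.
    by apply: lt_le_trans wt _; apply: mono => //; exact: le_trans (ltW s0) st.
  have p0 : 0 < w 0 `^ (1 - b) by exact: powR_gt0.
  have ds : d * s = (b - 1)^-1 by rewrite /s invfM mulrA mulfV ?gt_eqF// mul1r.
  have : (1 - b)^-1 = - (b - 1)^-1 by rewrite -invrN opprB.
  move: phase1; rewrite subr0 ds => /[swap] ->.
  have : 0 < (b - 1)^-1 by rewrite invr_gt0.
  nra.
have ws0 : 0 < w s by apply: lt_le_trans wt _; apply: mono => //; exact: ltW.
have pws : w s `^ (1 - a) <= 1.
  by rewrite -[leRHS](powRr0 (w s)); apply: ger_powR; [rewrite ws0|exact: ltW].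
have pwt : 0 < w t `^ (1 - a) by exact: powR_gt0.
have cts : (1 - a)^-1 <= c * (t - s).
  have : c * (c * (1 - a))^-1 = (1 - a)^-1.
    by rewrite invfM mulrA mulfV ?gt_eqF// mul1r.
  by move=> <-; apply: ler_wpM2l; [exact: ltW|rewrite lerBrDr].
have : 0 < (1 - a)^-1 by rewrite invr_gt0.
nra.
Qed.

(** * Fixed-time convergence to the minimizers *)

Theorem theorem1 (R : realType) (n : nat) (hn : (0 < n)%N)
    (f : 'rV[R]_n -> R) (xstar : 'rV[R]_n) (mu p q sigma rho : R)
    (gp gq : 'rV[R]_n -> 'rV[R]_n)
    (hf : C1 f) (hxstar : minimizers f xstar)
    (hmu : 0 < mu) (hPL : polyak_lojasiewicz mu (f xstar) f)
    (hp0 : 0 <= p) (hp1 : p < 1) (hq : 1 < q)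
    (hsigma : 0 < sigma) (hrho : 0 < rho)
    (hgp : classF p sigma gp) (hgq : classF q rho gq) :
  exists T : 'rV[R]_n -> R,
    (forall x0, 0 <= T x0 /\
       T x0 <= 1 / (mu * sigma * (1 - p)) + 1 / (mu * rho * (q - 1))) /\
    forall (x0 : 'rV[R]_n) (x : R -> 'rV[R]_n),
      inclusion_solution
        (filippov_comp (fun y => gp y + gq y) (gradient f)) x0 x ->
      forall t : R, T x0 <= t -> minimizers f (x t).
Proof.
pose B : R := 1 / (mu * sigma * (1 - p)) + 1 / (mu * rho * (q - 1)).
exists (fun=> B); split=> [x0|x0 x [xac _ xsol] t Bt].
  by split=> //; rewrite addr_ge0// divr_ge0// !mulr_ge0// ?ltW ?subr_gt0.
pose w u := 2 * mu * (f (x u) - f xstar).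
suff wt : w t = 0.
  move=> y; apply: le_trans (hxstar y).
  move: wt => /eqP; rewrite mulf_eq0 subr_eq0 => /orP[|/eqP-> //].
  by rewrite gt_eqF ?mulr_gt0.
have wge u : 0 <= w u by rewrite mulr_ge0 ?subr_ge0// mulr_ge0 ?ltW.
have wlip T : lipschitz_along x 0 T w.
  apply: lipschitz_alongZ.
  have [L L0 HL] := lipschitz_along_C1 T hf xac (lexx 0).
  exists L => // u /HL[r r0 Hr]; exists r => // v vT vr.
  by rewrite opprB addrA subrK; exact: Hr.
apply: (@fixed_time_zero _ _ x w ((1 + p) / 2) ((1 + q) / 2)
  (2 * mu * sigma) (2 * mu * rho)) => //.
- by rewrite divr_ge0// addr_ge0.
- lra.
- lra.
- by rewrite !mulr_gt0.
- by rewrite !mulr_gt0.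
- apply: ae_impl xsol => u H u0; have [dx [eta Feta Deta]] := H u0.
  have D := is_derive_along (hf.1 (x u)) dx.
  have Dw : is_derive u 1 w (2 * mu * dotv ('D_1 x u) (gradient f (x u))).
    have := is_deriveZ (2 * mu) (is_deriveB D (is_derive_cst (f xstar) u (1 : R))).
    by rewrite subr0.
  split; first exact: ex_derive.
  rewrite (@derive_val _ _ _ _ _ _ _ Dw) -Deta.
  have [_ gpb _ gpc] := hgp; have [_ gqb _ gqc] := hgq.
  have low := filippovD_dotv_ge gpb gqb (gpc (gradient f (x u)))
    (gqc (gradient f (x u))) Feta.
  have wg : w u <= enorm (gradient f (x u)) ^+ 2.
    by have := hPL (x u); rewrite /w; lra.
  have pow (s : R) : 0 <= s ->
      w u `^ ((1 + s) / 2) <= enorm (gradient f (x u)) `^ (1 + s).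
    move=> s0; have -> : 1 + s = 2%:R * ((1 + s) / 2) by rewrite mulrC divfK.
    rewrite [leRHS]powRrM powR_mulrn ?enorm_ge0//.
    have -> : 2 * ((1 + s) / 2) / 2 = (1 + s) / 2 by lra.
    apply: ge0_ler_powR => //; rewrite ?nnegrE ?sqr_ge0//.
    by rewrite divr_ge0// addr_ge0.
  have -> : dotv (- eta) (gradient f (x u)) = - dotv eta (gradient f (x u)).
    by rewrite -scaleN1r dotvZl mulN1r.
  have /(ler_wpM2l (ltW hsigma)) := pow p hp0.
  have /(ler_wpM2l (ltW hrho)) := pow q (ltW (lt_trans ltr01 hq)).
  have {}low := ler_wpM2l (ltW hmu) low.
  move=> /(ler_wpM2l (ltW hmu)) ? /(ler_wpM2l (ltW hmu)) ?; lra.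
- apply: le_trans Bt; rewrite /B !div1r.
  have -> : 2 * mu * sigma * (1 - (1 + p) / 2) = mu * sigma * (1 - p) by lra.
  have -> : 2 * mu * rho * ((1 + q) / 2 - 1) = mu * rho * (q - 1) by lra.
  by [].
Qed.
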